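(* For all integers $n\ge0$: \[ \overline{p}_{6}(9n+6)\equiv0\pmod{3}, \] \[ \overline{p}_{6}(8n+3)\equiv0\pmod{8}, \] \[ \overline{p}_{6}(8n+5)\equiv0\pmod{8}, \] \[ \overline{p}_{6}(24n+17)\equiv0\pmod{8}, \] \[ \overline{p}_{6}(24n+23)\equiv0\pmod{8}. \]
   Context: For $k\ge1$ let $f_k=\prod_{m\ge1}(1-q^{km})$. $\overline{p}_6(n)$ denotes the number of 2-color overpartitions of $n$ (the first occurrence of a part of each color may be overlined) in which one of the two colors appears only in parts that are multiples of $6$; its generating function is $\sum_{n\ge0}\overline{p}_6(n)q^n=\dfrac{f_2f_{12}}{f_1^2f_6^2}$. *)

(* Defs.v *)
From mathcomp Require Import all_boot.

Set Implicit Arguments.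
Unset Strict Implicit.
Unset Printing Implicit Defensive.

(* A 2-color overpartition of n is encoded by its multiplicities:                *)
(* x (i, c) = (m, o) means that the part i.+1 occurs exactly m times in color c, *)
(* and that the first of these occurrences is overlined iff o holds.  Parts and  *)
(* multiplicities never exceed n, so the bounds on i and m lose nothing.  The    *)
(* color [true] is the one that appears only in multiples of k.                  *)
Definition colored_parts (n : nat) : finType :=
  {ffun 'I_n * bool -> 'I_n.+1 * bool}.

Definition part_mult (n : nat) (x : colored_parts n) (i : 'I_n) (c : bool)
  : nat := (x (i, c)).1.

Definition part_overlined (n : nat) (x : colored_parts n) (i : 'I_n) (c : bool)
  : bool := (x (i, c)).2.

Definition part_sum (n : nat) (x : colored_parts n) : nat :=
  \sum_(i < n) \sum_(c : bool) part_mult x i c * i.+1.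

(* Only a part that does occur can be overlined. *)
Definition overlines_valid (n : nat) (x : colored_parts n) : bool :=
  [forall i, forall c, part_overlined x i c ==> (0 < part_mult x i c)].

Definition color_restricted (k n : nat) (x : colored_parts n) : bool :=
  [forall i, (0 < part_mult x i true) ==> (k %| i.+1)].

Definition overpbar (k n : nat) : nat :=
  #|[set x : colored_parts n |
      [&& overlines_valid x, color_restricted k x & part_sum x == n]]|.

(* Main.v *)
(* Writing phi(q) = sum_{x in Z} q^(x^2), Gauss' identity                       *)
(* phi(-q) = prod (1 - q^m) / (1 + q^m) turns the generating function into      *)
(* 1 / (phi(-q) phi(-q^6)).                                                     *)
(* Modulo 8, with phi(-q) = 1 + 2S and phi(-q^6) = 1 + 2T, it is                *)
(* (1 - 2S + 4S^2)(1 - 2T + 4T^2), whose n-th coefficient vanishes when n is    *)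
(* odd and not of the form x^2 + 6y^2.                                          *)
(* Modulo 3, phi(-q)^3 = phi(-q^3) gives                                        *)
(* phi(-q)^2 phi(-q^6)^2 / (phi(-q^3) phi(-q^18)); the terms of index 3n form,  *)
(* after q^3 -> q, the series w(q^3) phi(-q^2)^2 / (phi(-q) phi(-q^6)), which   *)
(* is w(q^3) phi(q) / phi(-q^6) since phi(-q^2)^2 = phi(q) phi(-q).  Only       *)
(* exponents congruent to a square modulo 3 occur, so none is 2 modulo 3.       *)
(* Power series are handled as polynomials modulo a power of X.                 *)

Require Import Defs.
From mathcomp Require Import all_boot all_algebra ring zify.

Set Implicit Arguments.
Unset Strict Implicit.
Unset Printing Implicit Defensive.

Import GRing.Theory.
Local Open Scope ring_scope.

(** The generating function W satisfies W phi(-q) phi(-q^6) = 1 ([overpbar_seriesE]), and phi(-q)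
    has only square exponents, so each congruence becomes a question about which integers certain
    quadratic forms represent. The product formula [gauss_theta] is the limit of the finite identity
    sum_j (-1)^j q^(j^2) [2n; n+j] = prod_(i<n) (1 - q^(2i+1))^2, with binomials in base q^2.

    Modulo 8 ([overpbar6_char8]), 4S^2 and 4T^2 vanish at odd exponents because the square of a
    series has even coefficients there. The terms in S, T and ST have exponents x^2 + 6y^2, a form
    that misses the required residues modulo 24 ([sqr_add_6sqr_mod24]).

    Modulo 3 ([overpbar6_char3]), cubing is the Frobenius map ([theta_cube]), which allows a
    3-dissection. If 3 divides x^2 + y^2 then so does 9; hence the dissected phi(-q)^2 is a series
    in q^3, and the only other factor that moves exponents modulo 3 is phi(q), by squares. *)

Definition eqmodX (R : nzSemiRingType) (N : nat) (p q : {poly R}) : Prop :=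
  forall i, (i < N)%N -> p`_i = q`_i.

Notation "p = q %[modX N ]" := (eqmodX N p q)
  (at level 70, q at next level, N at next level,
   format "p  =  q  %[modX  N ]") : ring_scope.

(** * Truncated power series *)

Section CongruenceModX.

Variable R : comNzRingType.
Implicit Types (p q r : {poly R}) (N : nat).

Lemma eqmodX_sym N p q : p = q %[modX N] -> q = p %[modX N].
Proof. by move=> pq i iN; rewrite pq. Qed.

Lemma eqmodX_trans N q p r :
  p = q %[modX N] -> q = r %[modX N] -> p = r %[modX N].
Proof. by move=> pq qr i iN; rewrite pq ?qr. Qed.

Lemma eqmodX_leq M N p q : (N <= M)%N -> p = q %[modX M] -> p = q %[modX N].
Proof. by move=> NM pq i iN; rewrite pq ?(leq_trans iN). Qed.

Lemma eqmodX_mul N p p' q q' :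
  p = p' %[modX N] -> q = q' %[modX N] -> p * q = p' * q' %[modX N].
Proof.
move=> pp' qq' i iN; rewrite !coefM; apply: eq_bigr => j _.
rewrite pp' ?qq' //; first exact: leq_ltn_trans (leq_subr _ _) iN.
by apply: leq_ltn_trans iN; rewrite -ltnS.
Qed.

Lemma eqmodX_mull N p q q' : q = q' %[modX N] -> p * q = p * q' %[modX N].
Proof. by move=> qq'; apply: eqmodX_mul. Qed.

Lemma eqmodX_mulr N p q q' : q = q' %[modX N] -> q * p = q' * p %[modX N].
Proof. by move=> qq'; apply: eqmodX_mul. Qed.

Lemma eqmodX_sum N (I : Type) (s : seq I) (P : pred I) (F G : I -> {poly R}) :
    (forall i, P i -> F i = G i %[modX N]) ->
  \sum_(i <- s | P i) F i = \sum_(i <- s | P i) G i %[modX N].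
Proof.
by move=> FG i iN; rewrite !coef_sum; apply: eq_bigr => j Pj; apply: FG.
Qed.

Lemma eqmodX_prod N (I : Type) (s : seq I) (P : pred I) (F G : I -> {poly R}) :
    (forall i, P i -> F i = G i %[modX N]) ->
  \prod_(i <- s | P i) F i = \prod_(i <- s | P i) G i %[modX N].
Proof.
move=> FG; apply: (big_ind2 (fun p q => p = q %[modX N])) => // p p' q q'.
exact: eqmodX_mul.
Qed.

(** A series with constant term 1 is invertible; this cancellation replaces every division by a
    product or a theta function. *)
Lemma eqmodX_mulIl N p q r :
  p`_0 = 1 -> p * q = p * r %[modX N] -> q = r %[modX N].
Proof.
move=> p0 pqr; elim/ltn_ind => i IHi iN.
have := pqr i iN; rewrite !coefM !big_ord_recl /= p0 !mul1r subn0.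
suff <- : \sum_(j < i) p`_(bump 0 j) * q`_(i - bump 0 j) =
          \sum_(j < i) p`_(bump 0 j) * r`_(i - bump 0 j) by exact: addIr.
by apply: eq_bigr => j _; rewrite IHi //; have := ltn_ord j; rewrite /bump; lia.
Qed.

Lemma eqmodXP N p q :
  p = q %[modX N] <-> exists r, p = q + r * 'X^N.
Proof.
split=> [pq|[r ->] i iN]; last by rewrite coefD coefMXn iN addr0.
exists (drop_poly N p - drop_poly N q).
apply/polyP => i; rewrite coefD coefMXn coefB !coef_drop_poly.
by case: ltnP => [/pq->|Ni]; rewrite ?addr0 // subnK // addrC subrK.
Qed.

Lemma eqmodX_comp N p q r :
  r`_0 = 0 -> p = q %[modX N] -> p \Po r = q \Po r %[modX N].
Proof.
move=> r0 /eqmodXP[d ->]; apply/eqmodXP.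
have ->: r = drop_poly 1 r * 'X.
  rewrite -[LHS](poly_take_drop 1) expr1.
  suff -> : take_poly 1 r = 0 by rewrite add0r.
  by apply/polyP => -[|i]; rewrite coef_take_poly coef0 ?r0.
exists ((d \Po (drop_poly 1 r * 'X)) * drop_poly 1 r ^+ N).
by rewrite comp_polyD comp_polyM comp_Xn_poly exprMn mulrA.
Qed.

Lemma prod_eqmodX1 N m n (c : nat -> {poly R}) (e : nat -> nat) (P : pred nat) :
    (forall i, (m <= i < n)%N -> P i -> (N <= e i)%N) ->
  \prod_(m <= i < n | P i) (1 + c i * 'X^(e i)) = 1 %[modX N].
Proof.
move=> Ne; rewrite big_nat_cond.
apply: (big_ind (fun p => p = 1 %[modX N])) => // [p q p1 q1|i /andP[mn Pi]].
  by rewrite -[1]mulr1; apply: eqmodX_mul.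
apply/eqmodXP; exists (c i * 'X^(e i - N)).
by rewrite -mulrA -exprD subnK ?Ne.
Qed.

Lemma prod_eqmodX_widen N m n (c : nat -> {poly R}) (e : nat -> nat)
    (P : pred nat) :
    (m <= n)%N -> (forall i, (m <= i < n)%N -> P i -> (N <= e i)%N) ->
  \prod_(i < n | P i) (1 + c i * 'X^(e i)) =
  \prod_(i < m | P i) (1 + c i * 'X^(e i)) %[modX N].
Proof.
move=> mn Ne; rewrite -!(big_mkord P (fun i => 1 + c i * 'X^(e i))).
rewrite (big_cat_nat (leq0n m) mn) /= -[X in _ = X %[modX _]]mulr1.
by apply: eqmodX_mull; apply: prod_eqmodX1.
Qed.

Lemma coef0_prod (I : Type) (s : seq I) (P : pred I) (F : I -> {poly R}) :
  (forall i, P i -> (F i)`_0 = 1) -> (\prod_(i <- s | P i) F i)`_0 = 1.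
Proof.
move=> F1; apply: (big_ind (fun p : {poly R} => p`_0 = 1)) => //.
  by rewrite coef1.
by move=> p q p1 q1; rewrite coef0M p1 q1 mulr1.
Qed.

End CongruenceModX.

(** * Gauss' product formula for phi(-q) *)

Section Gauss.

Variable R : comNzRingType.

Definition alt_squares (N : nat) : {poly R} :=
  \sum_(j < N) (-1) ^+ j.+1 * 'X^(j.+1 ^ 2).

(* phi(-q), truncated. *)
Definition theta (N : nat) : {poly R} := 1 + 2%:R * alt_squares N.

(* (-cq; q)_N in the usual notation. *)
Definition qpoch (c : R) (N : nat) : {poly R} :=
  \prod_(i < N) (1 + c%:P * 'X^(i.+1)).

Definition qpoch_dvd (c : R) (k N : nat) : {poly R} :=
  \prod_(i < N | (k %| i.+1)%N) (1 + c%:P * 'X^(i.+1)).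

Definition qpoch2 (N : nat) : {poly R} := \prod_(i < N) (1 - 'X^(i.+1.*2)).

Definition qpoch_odd (N : nat) : {poly R} := \prod_(i < N) (1 - 'X^(i.*2.+1)).

(* [gauss_row n j] is (-1)^j q^(j^2) times the Gaussian binomial [2n; n+j] in   *)
(* base q^2; two steps of Pascal's rule give the recurrence, folded at j = 0 by *)
(* the symmetry j <-> -j.                                                       *)
Fixpoint gauss_row (n : nat) : nat -> {poly R} :=
  if n is m.+1 then fun j =>
    if j is i.+1 then
      (1 + 'X^(4 * m + 2)) * gauss_row m i.+1
      - 'X^(2 * m + 1) * (gauss_row m i + gauss_row m i.+2)
    else (1 + 'X^(4 * m + 2)) * gauss_row m 0
      - 'X^(2 * m + 1) * (2%:R * gauss_row m 1)
  else fun j => (j == 0)%:R.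

Lemma gauss_row_small n j : (n < j)%N -> gauss_row n j = 0.
Proof.
elim: n j => [|n IHn] [|j] //= nj.
by rewrite !IHn ?addr0 ?mulr0 ?subr0 //; lia.
Qed.

(** The left side is the sum over all integers j, folded by symmetry. Summed this way, the
    recurrence multiplies it by 1 + q^(4n+2) - 2q^(2n+1) = (1 - q^(2n+1))^2. *)
Lemma sum_gauss_row n N : (n < N)%N ->
  gauss_row n 0 + 2%:R * \sum_(j < N) gauss_row n j.+1 = qpoch_odd n ^+ 2.
Proof.
elim: n N => [|n IHn] N nN.
  by rewrite /qpoch_odd big_ord0 expr1n big1 ?mulr0 ?addr0.
rewrite /qpoch_odd big_ord_recr /= exprMn -/(qpoch_odd n) -(IHn N); last lia.
rewrite sumrB -!mulr_sumr big_split /=.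
case: N nN => // N nN.
(* Shifting j changes the sum only by boundary terms; the upper ones vanish by [gauss_row_small]. *)
have -> : \sum_(j < N.+1) gauss_row n j =
    gauss_row n 0 + \sum_(j < N.+1) gauss_row n j.+1.
  rewrite big_ord_recl /=; congr (_ + _).
  by rewrite [RHS]big_ord_recr /= (@gauss_row_small n N.+1) ?addr0 //; lia.
have -> : \sum_(j < N.+1) gauss_row n j.+2 =
    \sum_(j < N.+1) gauss_row n j.+1 - gauss_row n 1.
  rewrite big_ord_recr [in RHS]big_ord_recl /=.
  by rewrite (@gauss_row_small n N.+2) ?addr0 1?addrC ?addKr //; lia.
have -> : n.*2.+1 = (2 * n + 1)%N by lia.
have -> : (4 * n + 2 = (2 * n + 1) * 2)%N by lia.
rewrite exprM; ring.
Qed.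

Lemma qpoch2S n : qpoch2 n.+1 = qpoch2 n * (1 - 'X^(n.+1.*2)).
Proof. by rewrite /qpoch2 big_ord_recr. Qed.

Lemma coef0_1cXn (c : {poly R}) n : (0 < n)%N -> (1 + c * 'X^n)`_0 = 1.
Proof. by move=> n0; rewrite coefD coefMXn n0 coef1 addr0. Qed.

Lemma coef0_1subXn n : (0 < n)%N -> (1 - 'X^n : {poly R})`_0 = 1.
Proof. by move=> n0; rewrite -mulN1r coef0_1cXn. Qed.

Lemma coef0_qpoch2 n : (qpoch2 n)`_0 = 1.
Proof. by apply: coef0_prod => i _; apply: coef0_1subXn. Qed.

(** The factorial formula for the Gaussian binomial with denominators cleared, where i = n - j. It
    is checked against the recurrence. *)
Lemma gauss_rowE n i j : (i + j = n)%N ->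
  gauss_row n j * qpoch2 (n + j) * qpoch2 i =
    (-1) ^+ j * 'X^(j ^ 2) * qpoch2 (2 * n).
Proof.
elim: n i j => [|n IHn] i j ijn.
  have [-> ->] : i = 0%N /\ j = 0%N by lia.
  by rewrite /qpoch2 !big_ord0 /= !mulr1.
(* Here and in [row2] the denominator gets one or two extra factors, to bring the terms of the
   recurrence to a common one. For j' > n both sides are 0. *)
have row1 i' j' : (i' + j' = n.+1)%N ->
    gauss_row n j' * qpoch2 (n + j') * qpoch2 i' =
    (-1) ^+ j' * 'X^(j' ^ 2) * qpoch2 (2 * n) * (1 - 'X^(i'.*2)).
  case: i' => [|i'] ij; first by rewrite gauss_row_small ?subrr; [ring|lia].
  by rewrite qpoch2S -(IHn i'); [ring|lia].
have row2 i' j' : (i' + j' = n.+2)%N ->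
    gauss_row n j' * qpoch2 (n + j') * qpoch2 i' =
    (-1) ^+ j' * 'X^(j' ^ 2) * qpoch2 (2 * n)
    * (1 - 'X^(i'.*2)) * (1 - 'X^(i'.-1.*2)).
  case: i' => [|i'] ij; first by rewrite gauss_row_small ?subrr; [ring|lia].
  by rewrite qpoch2S mulrA row1 /=; [ring|lia].
have -> : (2 * n.+1 = (2 * n).+2)%N by lia.
rewrite (qpoch2S (2 * n).+1) (qpoch2S (2 * n)); case: j ijn => [|j] ijn.
  have {ijn}-> : i = n.+1 by lia.
  transitivity ((1 + 'X^(4 * n + 2)) * (1 - 'X^(n.+1.*2)) ^+ 2
      * (gauss_row n 0 * qpoch2 (n + 0) * qpoch2 n)
    - 'X^(2 * n + 1) * (1 - 'X^(n.+1.*2)) * 2%:R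
      * (gauss_row n 1 * qpoch2 (n + 1) * qpoch2 n)).
    have -> : (n.+1 + 0 = n.+1)%N by lia.
    by rewrite addn0 (addn1 n) !qpoch2S /=; ring.
  rewrite IHn ?addn0 // (row1 n 1%N) ?(addn1 n) //.
  have -> : (4 * n + 2 = n * 4 + 2)%N by lia.
  have -> : (2 * n + 1 = n * 2 + 1)%N by lia.
  have -> : (n.+1.*2 = n * 2 + 2)%N by lia.
  have -> : (n.*2 = n * 2)%N by lia.
  have -> : ((2 * n).+1.*2 = n * 4 + 2)%N by lia.
  have -> : ((2 * n).+2.*2 = n * 4 + 4)%N by lia.
  by rewrite !exprD !exprM ?exp1n; ring.
have -> : (n.+1 + j.+1 = (n + j).+2)%N by lia.
transitivity ((1 + 'X^(4 * n + 2)) * (1 - 'X^((n + j).+2.*2))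
      * (gauss_row n j.+1 * qpoch2 (n + j.+1) * qpoch2 i)
    - 'X^(2 * n + 1) * (1 - 'X^((n + j).+1.*2)) * (1 - 'X^((n + j).+2.*2))
      * (gauss_row n j * qpoch2 (n + j) * qpoch2 i)
    - 'X^(2 * n + 1) * (gauss_row n j.+2 * qpoch2 (n + j.+2) * qpoch2 i)).
  by rewrite (addnS n j.+1) (addnS n j) !qpoch2S /=; ring.
rewrite (IHn i j) 1?(row1 i j.+1) ?(row2 i j.+2); try lia.
have {ijn}-> : n = (i + j)%N by lia.
have -> : (j.+1 ^ 2 = j ^ 2 + j * 2 + 1)%N by lia.
have -> : (j.+2 ^ 2 = j ^ 2 + j * 4 + 4)%N by lia.
have -> : (4 * (i + j) + 2 = i * 4 + j * 4 + 2)%N by lia.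
have -> : (2 * (i + j) + 1 = i * 2 + j * 2 + 1)%N by lia.
have -> : ((i + j + j).+1.*2 = i * 2 + j * 4 + 2)%N by lia.
have -> : ((i + j + j).+2.*2 = i * 2 + j * 4 + 4)%N by lia.
have -> : ((2 * (i + j)).+1.*2 = i * 4 + j * 4 + 2)%N by lia.
have -> : ((2 * (i + j)).+2.*2 = i * 4 + j * 4 + 4)%N by lia.
have -> : (i.*2 = i * 2)%N by lia.
(* At i = 0 the truncated [i.-1] is harmless, since the factor 1 - q^(2i) vanishes. *)
case: i => [|i].
  by rewrite !mul0n !add0n expr0 subrr !exprD !exprM !exprS; ring.
have -> : (i.+1.-1.*2 = i * 2)%N by lia.
have -> : (i.+1 * 2 = i * 2 + 2)%N by lia.
have -> : (i.+1 * 4 = i * 4 + 4)%N by lia.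
by rewrite !exprD !exprM !exprS; ring.
Qed.

Lemma qpoch2_widen m n :
  (m <= n)%N -> qpoch2 n = qpoch2 m %[modX m.+1.*2].
Proof.
have E k : qpoch2 k = \prod_(i < k) (1 + (-1) * 'X^(i.+1.*2)).
  by apply: eq_bigr => i _; rewrite mulN1r.
move=> mn; rewrite !E.
apply: (@prod_eqmodX_widen _ _ _ _ (fun=> -1) (fun i => i.+1.*2) predT) => //.
by move=> i; lia.
Qed.

Lemma qpoch_widen c m n : (m <= n)%N -> qpoch c n = qpoch c m %[modX m.+1].
Proof.
move=> mn.
apply: (@prod_eqmodX_widen _ _ _ _ (fun=> c%:P) (fun i => i.+1) predT) => //.
by move=> i; lia.
Qed.

(** The binomial [2n; n+j] tends to the inverse of the infinite product. The two errors start no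
    earlier than degrees j^2 + 2(n+j+1) and j^2 + 2(n-j+1) = 2n + 1 + (j-1)^2, whence the precision
    2n + 1. *)
Lemma gauss_row_qpoch2 n j : (j <= n)%N ->
  gauss_row n j * qpoch2 n = (-1) ^+ j * 'X^(j ^ 2) %[modX (2 * n).+1].
Proof.
move=> jn; pose i := (n - j)%N.
have shift M N (p q : {poly R}) : (N <= j ^ 2 + M)%N -> p = q %[modX M] ->
    (-1) ^+ j * 'X^(j ^ 2) * p = (-1) ^+ j * 'X^(j ^ 2) * q %[modX N].
  move=> NM /eqmodXP[r ->]; apply: eqmodX_leq NM _; apply/eqmodXP.
  by exists ((-1) ^+ j * r); rewrite exprD; ring.
have row : gauss_row n j * qpoch2 i = (-1) ^+ j * 'X^(j ^ 2) %[modX (2 * n).+1].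
  apply: (@eqmodX_mulIl _ _ (qpoch2 (n + j))); first exact: coef0_qpoch2.
  rewrite mulrCA mulrA gauss_rowE ?subnK // [X in _ = X %[modX _]]mulrC.
  by apply: (shift (n + j).+1.*2); [|apply: qpoch2_widen]; lia.
apply: (@eqmodX_mulIl _ _ (qpoch2 i)); first exact: coef0_qpoch2.
rewrite mulrCA mulrA.
apply: eqmodX_trans (eqmodX_mulr (qpoch2 n) row) _.
rewrite [X in _ = X %[modX _]]mulrC.
apply: (shift i.+1.*2); last by apply: qpoch2_widen; rewrite leq_subr.
by rewrite /i -(subnK jn); nia.
Qed.

Lemma theta_prod n :
  theta n = qpoch2 n * qpoch_odd n ^+ 2 %[modX (2 * n).+1].
Proof.
rewrite -(sum_gauss_row (ltnSn n)) big_ord_recr /=.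
rewrite (gauss_row_small (ltnSn n)) addr0.
rewrite mulrC mulrDl -mulrA mulr_suml /theta => i iN.
rewrite !coefD; congr (_ + _).
  by rewrite (gauss_row_qpoch2 (leq0n n) iN) expr0 mul1r.
move: i iN; apply: eqmodX_mull; apply: eqmodX_sum => j _.
by apply: eqmodX_sym; apply: gauss_row_qpoch2.
Qed.

Lemma qpochN1_odd_even n : qpoch (-1) (2 * n) = qpoch_odd n * qpoch2 n.
Proof.
elim: n => [|n IHn]; first by rewrite /qpoch /qpoch_odd /qpoch2 !big_ord0 mulr1.
have -> : (2 * n.+1 = (2 * n).+2)%N by lia.
rewrite /qpoch /qpoch_odd /qpoch2 !big_ord_recr /= -/(qpoch (-1) _) IHn.
have -> : (n.*2.+1 = (2 * n).+1)%N by lia.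
have -> : (n.+1.*2 = (2 * n).+2)%N by lia.
by rewrite /qpoch_odd /qpoch2 polyCN; ring.
Qed.

Lemma qpochN1_qpoch1 n : qpoch (-1) n * qpoch 1 n = qpoch2 n.
Proof.
rewrite /qpoch /qpoch2 -big_split /=; apply: eq_bigr => i _.
by rewrite -muln2 exprM polyCN; ring.
Qed.

(** Follows from [theta_prod] by splitting exponents into odd and even. The products are first
    lengthened to 2N factors, where that split is exact. *)
Lemma gauss_theta N : theta N * qpoch 1 N = qpoch (-1) N %[modX N.+1].
Proof.
have le2 : (N <= 2 * N)%N by lia.
apply: eqmodX_trans (qpoch_widen (-1) le2).
apply: eqmodX_trans (eqmodX_mull _ (eqmodX_sym (qpoch_widen 1 le2))) _.
apply: (@eqmodX_leq _ (2 * N).+1); first lia.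
apply: eqmodX_trans (eqmodX_mulr _ (@theta_prod N)) _.
have -> : qpoch2 N * qpoch_odd N ^+ 2 * qpoch 1 (2 * N) =
    qpoch_odd N * qpoch2 (2 * N).
  by rewrite -(qpochN1_qpoch1 (2 * N)) qpochN1_odd_even; ring.
rewrite qpochN1_odd_even; apply: eqmodX_mull.
by apply: eqmodX_leq (qpoch2_widen le2); lia.
Qed.

Lemma coef0_qpoch c N : (qpoch c N)`_0 = 1.
Proof. by apply: coef0_prod => i _; apply: coef0_1cXn. Qed.

Lemma coef0_qpoch_dvd c k N : (qpoch_dvd c k N)`_0 = 1.
Proof. by apply: coef0_prod => i _; apply: coef0_1cXn. Qed.

Lemma qpoch_comp_Xn c k N : (0 < k)%N ->
  qpoch c N \Po 'X^k = qpoch_dvd c k N %[modX N.+1].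
Proof.
move=> k0; have -> : qpoch c N \Po 'X^k = qpoch_dvd c k (N * k).
  rewrite /qpoch rmorph_prod /=.
  (* Going from N k to (N+1) k adds k exponents, of which only the last is a multiple of k. *)
  elim: N => [|N IHN]; first by rewrite /qpoch_dvd !big_ord0.
  case: k k0 IHN => // k _ IHN; rewrite big_ord_recr IHN /=.
  have -> : (N.+1 * k.+1 = (N * k.+1 + k).+1)%N by lia.
  rewrite /qpoch_dvd -!(big_mkord (fun i => k.+1 %| i.+1)%N
    (fun i => 1 + c%:P * 'X^(i.+1))).
  rewrite [RHS](big_cat_nat (leq0n (N * k.+1))) /=; last lia.
  rewrite comp_polyD comp_polyM !comp_polyC comp_Xn_poly -exprM; congr (_ * _).
  rewrite big_mkcond big_nat_recr ?leq_addr //= -addnS -mulSnr dvdn_mull //.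
  rewrite [(k.+1 * _)%N]mulnC -big_mkcond big_nat_cond big1 ?mul1r //.
  move=> i /andP[/andP[lo hi] /dvdnP[m im]]; exfalso.
  have : (N * k.+1 < m * k.+1 < N.+1 * k.+1)%N by lia.
  by rewrite !ltn_pmul2r //; lia.
apply: (@prod_eqmodX_widen _ _ _ _ (fun=> c%:P) (fun i => i.+1)
  (fun i => k %| i.+1)%N); first by rewrite leq_pmulr.
by move=> i; lia.
Qed.

Lemma theta_comp_Xn k N : (0 < k)%N ->
  (theta N \Po 'X^k) * qpoch_dvd 1 k N = qpoch_dvd (-1) k N %[modX N.+1].
Proof.
move=> k0; apply: eqmodX_trans (qpoch_comp_Xn (-1) k0).
apply: eqmodX_trans (eqmodX_mull _ (eqmodX_sym (qpoch_comp_Xn 1 k0))) _.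
rewrite -comp_polyM; apply: eqmodX_comp (@gauss_theta N).
by rewrite coefXn; case: k k0.
Qed.

(* By [gauss_theta] this reduces to products: the factors with odd exponents    *)
(* cancel, those with even exponents double up.                                 *)
Lemma theta_mul_thetaN N :
  theta N * (theta N \Po (- 'X)) = (theta N \Po 'X^2) ^+ 2 %[modX N.+1].
Proof.
set t := theta N; set t' := t \Po (- 'X); set t2 := t \Po 'X^2.
have tN (c : R) : qpoch c N \Po (- 'X) =
    \prod_(i < N) (1 + c%:P * (- 'X) ^+ i.+1).
  rewrite /qpoch rmorph_prod /=; apply: eq_bigr => i _.
  by rewrite comp_polyD comp_polyM !comp_polyC comp_Xn_poly.
have X0 : (- 'X : {poly R})`_0 = 0 by rewrite coefN coefX oppr0.
have E1 := @gauss_theta N.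
have E2 := eqmodX_comp X0 E1; rewrite comp_polyM !tN -/t -/t' in E2.
have E3 := @theta_comp_Xn 2 N isT; rewrite -/t -/t2 in E3.
have key : qpoch (-1) N * \prod_(i < N) (1 + (-1)%:P * (- 'X) ^+ i.+1)
      * qpoch_dvd 1 2 N ^+ 2 =
    qpoch 1 N * \prod_(i < N) (1 + 1%:P * (- 'X) ^+ i.+1)
      * qpoch_dvd (-1) 2 N ^+ 2 :> {poly R}.
  rewrite /qpoch /qpoch_dvd -!prodrXl.
  rewrite !(big_mkcond (fun i : 'I_N => (2 %| i.+1)%N)) /=.
  rewrite -!big_split /=; apply: eq_bigr => i _.
  rewrite exprNn dvdn2 polyCN -signr_odd /= polyC1.
  by case: (odd i) => /=; rewrite ?expr0 ?expr1; ring.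
set Q := qpoch 1 N * \prod_(i < N) (1 + 1%:P * (- 'X) ^+ i.+1) in key *.
apply: (@eqmodX_mulIl _ _ (Q * qpoch_dvd 1 2 N ^+ 2)).
  rewrite expr2 !coef0M coef0_qpoch coef0_qpoch_dvd !mulr1 mul1r.
  apply: coef0_prod => i _; by rewrite exprNn mulrA coef0_1cXn.
have -> : Q * qpoch_dvd 1 2 N ^+ 2 * (t * t') =
    (t * qpoch 1 N) * (t' * \prod_(i < N) (1 + 1%:P * (- 'X) ^+ i.+1))
    * qpoch_dvd 1 2 N ^+ 2 by rewrite /Q; ring.
apply: eqmodX_trans (eqmodX_mulr _ (eqmodX_mul E1 E2)) _.
rewrite key -mulrA; apply: eqmodX_mull.
rewrite mulrC -exprMn !expr2; apply: eqmodX_sym.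
by apply: eqmodX_mul.
Qed.

(** * The generating function of restricted overpartitions *)

Lemma sum_expS_mul1B (Y : {poly R}) M :
  (\sum_(m < M) Y ^+ m.+1) * (1 - Y) = Y - Y ^+ M.+1.
Proof.
elim: M => [|M IHM]; first by rewrite big_ord0 expr1 subrr mul0r.
by rewrite big_ord_recr mulrDl IHM /= !exprS; ring.
Qed.

Definition overpart_series (n e : nat) : {poly R} :=
  \sum_(v : 'I_n.+1 * bool | v.2 ==> (0 < v.1)%N) 'X^(v.1 * e).

(** One part size contributes 1 + 2(q^e + q^(2e) + ...) = (1 + q^e) / (1 - q^e), the 2 coming from
    the overline. Cutting multiplicities at n leaves the error -2q^(e(n+1)). *)
Lemma overpart_seriesE n e : (0 < e)%N ->
  overpart_series n e * (1 - 'X^e) = 1 + 'X^e %[modX n.+1].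
Proof.
move=> e0; have -> : overpart_series n e =
    1 + 2%:R * \sum_(m < n) ('X^e) ^+ m.+1.
  rewrite /overpart_series big_mkcond.
  rewrite -(pair_bigA _ (fun (m : 'I_n.+1) (o : bool) =>
    if o ==> (0 < m)%N then 'X^(m * e) else 0 : {poly R})) /=.
  under eq_bigr do rewrite big_bool /=.
  rewrite big_ord_recl /= add0r mul0n expr0 mulr_sumr; congr (_ + _).
  by apply: eq_bigr => m _; rewrite mulnC exprM; ring.
rewrite mulrDl -mulrA sum_expS_mul1B mul1r; apply/eqmodXP.
exists (- 2%:R * 'X^(e * n.+1 - n.+1)).
rewrite -mulrA -exprD subnK; last by rewrite leq_pmull.
by rewrite exprM; ring.
Qed.

(* The n-th coefficient is [overpbar k n]; beyond degree n the truncation of    *)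
(* parts and multiplicities shows.                                              *)
Definition overpbar_series (k n : nat) : {poly R} :=
  \prod_(p : 'I_n * bool)
    \sum_(v : 'I_n.+1 * bool | (v.2 ==> (0 < v.1)%N)
         && ((p.2 && (0 < v.1)%N) ==> (k %| p.1.+1)%N))
      'X^(v.1 * p.1.+1).

(** When the product is expanded, choosing one term in each factor is the same as giving an encoded
    overpartition, and the degree is its part sum. *)
Lemma coef_overpbar_series k n : (overpbar_series k n)`_n = (overpbar k n)%:R.
Proof.
rewrite /overpbar_series bigA_distr_big_dep /= coef_sum /overpbar.
rewrite -sum1_card natr_sum; under [RHS]eq_bigl => x do rewrite inE.
rewrite big_mkcond [RHS]big_mkcond /=; apply: eq_bigr => x _.
rewrite prodrXr coefXn.
have -> : (\sum_(p : 'I_n * bool) (x p).1 * p.1.+1)%N = part_sum x.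
  by rewrite /part_sum pair_bigA; apply: eq_bigr => -[].
have -> : (x \in family (fun (p : 'I_n * bool) (v : 'I_n.+1 * bool) =>
      (v.2 ==> (0 < v.1)%N)
      && ((p.2 && (0 < v.1)%N) ==> (k %| p.1.+1)%N)))
    = overlines_valid x && color_restricted k x.
  apply/familyP/andP => [H | [/forallP ov /forallP cr] [i c]].
    split; apply/forallP => i; first apply/forallP => c.
      by have /andP[] := H (i, c).
    by have /andP[] := H (i, true).
  rewrite unfold_in /=; apply/andP; split; first exact: (forallP (ov i) c).
  by apply/implyP => /andP[cT]; move: (cr i); rewrite -cT => /implyP; apply.
rewrite andbA; case: ifP => //= _.
by rewrite eq_sym; case: eqP.
Qed.

Lemma overpbar_seriesE k n : (0 < k)%N ->
  overpbar_series k n * (theta n * (theta n \Po 'X^k)) = 1 %[modX n.+1].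
Proof.
move=> k0; pose A (i : 'I_n) := overpart_series n i.+1.
have EA (P : pred 'I_n) : (\prod_(i < n | P i) A i)
      * (\prod_(i < n | P i) (1 + (-1)%:P * 'X^(i.+1)))
    = \prod_(i < n | P i) (1 + 1%:P * 'X^(i.+1)) %[modX n.+1].
  rewrite -big_split; apply: eqmodX_prod => i _.
  by rewrite polyCN mulN1r polyC1 mul1r; apply: overpart_seriesE.
have -> : overpbar_series k n =
    (\prod_i A i) * (\prod_(i < n | (k %| i.+1)%N) A i).
  rewrite [X in _ * X]big_mkcond -big_split /overpbar_series /=.
  rewrite -(pair_bigA _ (fun (i : 'I_n) (c : bool) =>
    \sum_(v : 'I_n.+1 * bool | (v.2 ==> (0 < v.1)%N)
      && ((c && (0 < v.1)%N) ==> (k %| i.+1)%N)) 'X^(v.1 * i.+1) : {poly R})).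
  apply: eq_bigr => i _.
  rewrite big_bool [LHS]mulrC /A /overpart_series /=; congr (_ * _).
    by apply: eq_bigl => v; rewrite andbT.
  case: ifP => ki.
    by apply: eq_bigl => v; rewrite implybT andbT.
  (* In the restricted color a non-multiple of k can only be absent and not overlined, contributing
     the factor 1. *)
  rewrite (big_pred1 (ord0, false)) ?mul0n ?expr0 // => -[[[|m] lm] [|]] //=.
apply: (@eqmodX_mulIl _ _ (qpoch 1 n * qpoch_dvd 1 k n)).
  by rewrite coef0M coef0_qpoch coef0_qpoch_dvd mulr1.
have -> : qpoch 1 n * qpoch_dvd 1 k n *
    (\prod_i A i * \prod_(i < n | (k %| i.+1)%N) A i
     * (theta n * (theta n \Po 'X^k))) =
    (\prod_i A i * \prod_(i < n | (k %| i.+1)%N) A i)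
    * ((theta n * qpoch 1 n) * ((theta n \Po 'X^k) * qpoch_dvd 1 k n)) by ring.
apply: eqmodX_trans (eqmodX_mull _
  (eqmodX_mul (@gauss_theta n) (theta_comp_Xn k0))) _.
rewrite mulrACA mulr1; apply: eqmodX_mul; exact: EA.
Qed.

End Gauss.

(** * Supports of coefficients and dissections *)

Section Supports.

Variable R : comNzRingType.
Implicit Types (p q h g : {poly R}) (N : nat).

Lemma coefM_neq0 p q i :
  (p * q)`_i != 0 -> exists a b, [/\ i = (a + b)%N, p`_a != 0 & q`_b != 0].
Proof.
rewrite coefM => nz.
have [j pqj | pq0] := pickP [pred j : 'I_i.+1 | p`_j * q`_(i - j) != 0].
  exists j, (i - j)%N; split.
  - by rewrite subnKC // -ltnS.
  - by apply: contraNneq pqj => ->; rewrite mul0r.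
  - by apply: contraNneq pqj => ->; rewrite mulr0.
by rewrite big1 ?eqxx // in nz => j _; apply/eqP/negbFE/pq0.
Qed.

Lemma coef0_theta N : (theta R N)`_0 = 1.
Proof.
rewrite /theta coefD coef1 mulr_natl coefMn coef_sum big1 ?mul0rn ?addr0 //.
by move=> j _; rewrite coefMXn expn_gt0.
Qed.

Lemma coef_alt_squares_neq0 N i :
  (alt_squares R N)`_i != 0 -> exists x, i = (x ^ 2)%N.
Proof.
rewrite coef_sum => nz.
have [j /eqP -> | sq] := pickP [pred j : 'I_N | i == (j.+1 ^ 2)%N].
  by exists j.+1.
rewrite big1 ?eqxx // in nz => j _.
by rewrite -polyCN -polyC_exp coefCM coefXn [i == _]sq mulr0.
Qed.

Lemma coef_theta_neq0 N i : (theta R N)`_i != 0 -> exists x, i = (x ^ 2)%N.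
Proof.
rewrite /theta coefD coef1 mulr_natl coefMn.
case: (i =P 0%N) => [-> _|_]; first by exists 0%N.
rewrite add0r => nz; apply: (@coef_alt_squares_neq0 N).
by apply: contraNneq nz => ->; rewrite mul0rn.
Qed.

Lemma coef_comp_oppX p i : (p \Po (- 'X))`_i = (-1) ^+ i * p`_i.
Proof.
elim/poly_ind: p i => [|p c IHp] i; first by rewrite comp_poly0 !coef0 mulr0.
rewrite comp_polyD comp_polyM comp_polyX comp_polyC mulrN !coefD coefN !coefMX.
by case: i => [|i] /=; rewrite !coefC /= ?IHp ?exprS ?expr0; ring.
Qed.

(** Writing p = e(q^2) + q o(q^2), the odd part of p^2 is the cross term 2q e(q^2) o(q^2). *)
Lemma coef_sqr_odd p i : exists c, (p ^+ 2)`_(i.*2.+1) = c *+ 2.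
Proof.
set e := even_poly p \Po 'X^2; set o := odd_poly p \Po 'X^2.
exists (e * o * 'X)`_(i.*2.+1).
have -> : p ^+ 2 = (even_poly p ^+ 2 + odd_poly p ^+ 2 * 'X) \Po 'X^2
    + (e * o * 'X) *+ 2.
  rewrite comp_polyD (comp_polyM _ 'X) comp_polyX !rmorphXn /= -/e -/o.
  rewrite -[p in LHS]poly_even_odd -/e -/o; ring.
by rewrite coefD coefMn coef_comp_poly_Xn // dvdn2 /= odd_double add0r.
Qed.

(** Dividing by a series in q^m with constant term 1 does not mix residue classes of exponents
    modulo m. *)
Lemma coef_mulIl_residue m r N p h g :
    h`_0 = 1 -> (forall i, h`_i != 0 -> (m %| i)%N) ->
    h * p = g %[modX N] -> (forall i, i = r %[mod m] -> g`_i = 0) ->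
  forall i, (i < N)%N -> i = r %[mod m] -> p`_i = 0.
Proof.
move=> h0 hm hpg g0; elim/ltn_ind => i IHi iN ir.
have := hpg i iN; rewrite g0 // coefM big_ord_recl /= h0 mul1r subn0.
rewrite big1 ?addr0 // => j _; have ji := ltn_ord j.
have [->|/hm/dvdnP[a aj]] := eqVneq h`_(bump 0 j) 0; first by rewrite mul0r.
rewrite /bump /= add1n in aj *.
rewrite [p`__]IHi ?mulr0 //; [lia | lia |].
by rewrite -ir -[in RHS](subnK ji) addnC aj modnMDl.
Qed.

(** The dissection operator U_m: keep the exponents divisible by m, then replace q^m by q. *)
Definition section (m : nat) p : {poly R} := \poly_(i < size p) p`_(m * i).

Lemma coef_section m p i : (0 < m)%N -> (section m p)`_i = p`_(m * i).
Proof.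
move=> m0; rewrite coef_poly; case: ltnP => // pi; rewrite nth_default //.
by apply: leq_trans pi _; rewrite leq_pmull.
Qed.

Lemma section_mul_comp m p q :
  (0 < m)%N -> section m (p * (q \Po 'X^m)) = section m p * q.
Proof.
move=> m0; elim/poly_ind: q => [|q c IHq].
  by apply/polyP => i; rewrite coef_section // comp_poly0 !mulr0 !coef0.
apply/polyP => i; rewrite coef_section // comp_polyD comp_polyM comp_polyX.
rewrite comp_polyC !mulrDr !mulrA !coefD !coefMC coef_section // coefMXn coefMX.
congr (_ + _); rewrite -IHq coef_section //.
case: i => [|i]; first by rewrite muln0 m0.
by rewrite mulnS ltnNge leq_addr addKn.
Qed.

Lemma section_eqmodX m M N p q : (0 < m)%N -> (m * M < N + m)%N ->
  p = q %[modX N] -> section m p = section m q %[modX M].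
Proof.
move=> m0 MN pq i iM; rewrite !coef_section // pq //.
have : (m * i.+1 <= m * M)%N by rewrite leq_mul2l iM orbT.
by lia.
Qed.

(** Cubing is additive in characteristic 3 and fixes the coefficients 1, 2 and the signs. *)
Lemma theta_cube N : 3%:R = 0 :> R -> theta R N ^+ 3 = theta R N \Po 'X^3.
Proof.
move=> R3; have P3 : 3%:R = 0 :> {poly R} by rewrite -polyC_natr R3.
have cubeD (p q : {poly R}) : (p + q) ^+ 3 = p ^+ 3 + q ^+ 3.
  transitivity (p ^+ 3 + q ^+ 3 + 3%:R * (p ^+ 2 * q + p * q ^+ 2)); first ring.
  by rewrite P3 mul0r addr0.
rewrite /theta cubeD exprMn comp_polyD comp_polyM !rmorph_nat rmorph_sum /=.
rewrite expr1n comp_polyC.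
rewrite (big_morph (fun p : {poly R} => p ^+ 3) cubeD (expr0n _ 3)).
have -> : 2%:R ^+ 3 = 2%:R :> {poly R}.
  transitivity (2%:R + 2%:R * 3%:R : {poly R}); first by ring.
  by rewrite P3 mulr0 addr0.
congr (_ + _ * _); apply: eq_bigr => j _.
rewrite comp_polyM rmorphXn /= rmorphN1 comp_Xn_poly exprMn; congr (_ * _).
  by rewrite -exprM mulnC exprM; congr (_ ^+ _); ring.
by rewrite -!exprM mulnC.
Qed.

End Supports.

(** * The congruences modulo 3 and 8 *)

Lemma natr_Zp_eq0 m k : (1 < m)%N -> k%:R = 0 :> 'Z_m -> k = 0 %[mod m].
Proof.
by move=> m1 /(congr1 val); rewrite /= val_Zp_nat // mod0n.
Qed.

Lemma overpbar6_char3 (R : comNzRingType) n : 3%:R = 0 :> R ->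
  (overpbar 6 (9 * n + 6))%:R = 0 :> R.
Proof.
move=> R3; set t := (9 * n + 6)%N.
rewrite -coef_overpbar_series; set W := overpbar_series _ 6 t.
have WE := @overpbar_seriesE R 6 t isT; rewrite -/W in WE.
pose a := theta R t; pose a2 := a \Po 'X^2.
have -> : W`_t = (section 3 W)`_(3 * n + 2).
  by rewrite coef_section //; congr (W`_ _); rewrite /t; lia.
have a6E : (a \Po 'X^6) = a2 \Po 'X^3.
  by rewrite -comp_polyA comp_Xn_poly -exprM.
(* This is U_3 applied to W phi(-q^3) phi(-q^18) = phi(-q)^2 phi(-q^6)^2, which is W phi(-q)
   phi(-q^6) = 1 after cubing both theta factors. *)
have QE : section 3 W * (a * (a \Po 'X^6)) = section 3 (a ^+ 2) * a2 ^+ 2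
    %[modX 3 * n + 3].
  rewrite -!section_mul_comp //.
  apply: (@section_eqmodX _ _ _ t.+1); [by []|by rewrite /t; lia|].
  have -> : W * ((a * (a \Po 'X^6)) \Po 'X^3) =
      a ^+ 2 * (a \Po 'X^6) ^+ 2 * (W * (a * (a \Po 'X^6))).
    rewrite comp_polyM -[a \Po 'X^3]theta_cube // -/a.
    have -> : (a \Po 'X^6) \Po 'X^3 = (a \Po 'X^6) ^+ 3.
      rewrite -[RHS]rmorphXn /= theta_cube // -!comp_polyA !comp_Xn_poly.
      by rewrite -!exprM mulnC.
    ring.
  rewrite rmorphXn /= -a6E -[X in _ = X %[modX _]]mulr1.
  exact: eqmodX_mull WE.
(* Since phi(-q^2)^2 = phi(q) phi(-q), the factor phi(-q) cancels. *)
have sq0 : section 3 (a ^+ 2) * (a \Po (- 'X)) =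
    (a \Po 'X^6) * section 3 W %[modX 3 * n + 3].
  apply: (@eqmodX_mulIl _ _ a); first exact: coef0_theta.
  have -> : a * ((a \Po 'X^6) * section 3 W) =
     section 3 W * (a * (a \Po 'X^6)) by ring.
  apply: eqmodX_sym; apply: eqmodX_trans QE _; rewrite [a * _]mulrCA.
  apply: eqmodX_mull; apply: eqmodX_sym.
  by apply: eqmodX_leq (@theta_mul_thetaN _ t); rewrite /t; lia.
apply: (coef_mulIl_residue (m := 3) (r := 2) _ _ (eqmodX_sym sq0))
  => [||i i2||].
- by rewrite coef_comp_poly_Xn // coef0_theta.
- move=> i; rewrite coef_comp_poly_Xn //; case: ifP; last by rewrite eqxx.
  by move=> /(@dvdn_trans _ 3)->.
- apply/eqP/negPn/negP => /coefM_neq0[b [c [ibc]]].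
  rewrite coef_section // coef_comp_oppX expr2.
  move=> /coefM_neq0[x [y [bxy /coef_theta_neq0[u xu] /coef_theta_neq0[v yv]]]].
  have [->|/coef_theta_neq0[w cw] _] := eqVneq (a`_c) 0.
    by rewrite mulr0 eqxx.
  (* From u^2 + v^2 = 3b both squares are multiples of 9, so 3 divides b, and i = b + w^2 cannot be
     2 modulo 3. *)
  have sq_mod9 z : exists k, (z ^ 2 = 9 * k \/ z ^ 2 = 3 * k + 1)%N.
    have := divn_eq z 3; have := ltn_pmod z (isT : 0 < 3)%N.
    set k := (z %/ 3)%N; case: (z %% 3)%N => [|[|[|//]]] _ ->.
    - by exists (k ^ 2)%N; left; ring.
    - by exists (3 * k ^ 2 + 2 * k)%N; right; ring.
    - by exists (3 * k ^ 2 + 4 * k + 1)%N; right; ring.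
  have [[u' ?] [v' ?] [w' ?]] := And3 (sq_mod9 u) (sq_mod9 v) (sq_mod9 w).
  by lia.
- by lia.
- by rewrite mulnC modnMDl.
Qed.

Lemma overpbar6_char8 (R : comNzRingType) t : 8%:R = 0 :> R ->
    odd t -> (forall x y, (x ^ 2 + 6 * y ^ 2)%N <> t) ->
  (overpbar 6 t)%:R = 0 :> R.
Proof.
move=> R8 todd tN; have P8 : 8%:R = 0 :> {poly R} by rewrite -polyC_natr R8.
rewrite -coef_overpbar_series; set W := overpbar_series R 6 t.
have WE := @overpbar_seriesE R 6 t isT; rewrite -/W in WE.
pose S := alt_squares R t.
pose T := S \Po 'X^6.
have thS : theta R t = 1 + 2%:R * S by [].
have thT : theta R t \Po 'X^6 = 1 + 2%:R * T.
  by rewrite thS comp_polyD comp_polyM comp_polyC rmorph_nat.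
have {}WE : W = (1 - 2%:R * S + 4%:R * S ^+ 2) * (1 - 2%:R * T + 4%:R * T ^+ 2)
    %[modX t.+1].
  (* The geometric series for 1 / (1 + 2q) stops here because (2q)^3 is 0 modulo 8. *)
  have inv (q : {poly R}) : (1 - 2%:R * q + 4%:R * q ^+ 2) * (1 + 2%:R * q) = 1.
    by transitivity (1 + 8%:R * q ^+ 3); [ring | rewrite P8 mul0r addr0].
  apply: (@eqmodX_mulIl _ _ (theta R t * (theta R t \Po 'X^6))).
    by rewrite coef0M coef_comp_poly_Xn // !coef0_theta mulr1.
  rewrite mulrC [X in _ = X %[modX _]]mulrC mulrACA {2}thT thS !inv mulr1.
  exact: WE.
have nS x : S`_x != 0 -> exists y, x = (y ^ 2)%N.
  exact: coef_alt_squares_neq0.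
have nT x : T`_x != 0 -> exists y, x = (6 * y ^ 2)%N.
  rewrite coef_comp_poly_Xn //; case: ifP => [/dvdnP[k ->]|_]; last by case/eqP.
  by rewrite mulnK // => /nS[y ->]; exists y; rewrite mulnC.
have St : S`_t = 0.
  apply/eqP/negPn/negP => /nS[y ty].
  by apply: (tN y 0%N); rewrite muln0 addn0.
have Tt : T`_t = 0 by apply/eqP/negPn/negP => /nT[y ty]; apply: (tN 0%N y).
have STt : (S * T)`_t = 0.
  apply/eqP/negPn/negP => /coefM_neq0[u [v [tE /nS[x ux] /nT[y vy]]]].
  by apply: (tN x y); rewrite tE ux vy.
have sqr_t (q : {poly R}) : (4%:R * q ^+ 2)`_t = 0.
  rewrite -(odd_double_half t) todd add1n; have [c cE] := coef_sqr_odd q t./2.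
  by rewrite mulr_natl coefMn cE -mulrnA -mulr_natl R8 mul0r.
rewrite WE //.
(* The remaining cross terms carry a factor 8. *)
have -> : (1 - 2%:R * S + 4%:R * S ^+ 2) * (1 - 2%:R * T + 4%:R * T ^+ 2) =
    1 - 2%:R * S - 2%:R * T + 4%:R * S ^+ 2 + 4%:R * T ^+ 2 + 4%:R * (S * T)
    + 8%:R * (2%:R * S ^+ 2 * T ^+ 2 - S * T ^+ 2 - S ^+ 2 * T) by ring.
rewrite P8 mul0r addr0 !coefD !coefN !sqr_t !mulr_natl !coefMn St Tt STt coef1.
by case: t todd {tN WE St Tt STt sqr_t W S T thS thT nS nT} => // t _;
  rewrite !mul0rn oppr0 !addr0.
Qed.

Lemma overpbar6_mod8 t : odd t -> (forall x y, (x ^ 2 + 6 * y ^ 2)%N <> t) ->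
  overpbar 6 t = 0 %[mod 8].
Proof.
move=> todd tN; apply: (@natr_Zp_eq0 8) => //.
by apply: overpbar6_char8 => //; apply/val_inj.
Qed.

Lemma overpbar6_mod3 n : overpbar 6 (9 * n + 6) = 0 %[mod 3].
Proof.
by apply: (@natr_Zp_eq0 3) => //; apply: overpbar6_char3; apply/val_inj.
Qed.

Local Close Scope ring_scope.

(** These residues cover the four progressions: 8n+3 gives 3, 11, 19 and 8n+5 gives 5, 13, 21. The
    proof checks all residue pairs. *)
Lemma sqr_add_6sqr_mod24 x y :
  (x ^ 2 + 6 * y ^ 2) %% 24 \notin [:: 3; 5; 11; 13; 17; 19; 21; 23]%N.
Proof.
have -> : ((x ^ 2 + 6 * y ^ 2) %% 24 =
    ((x %% 24) ^ 2 + 6 * (y %% 24) ^ 2) %% 24)%N.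
  by rewrite -modnDm -modnMmr -(modnXm 2 24 y) modnMmr -(modnXm 2 24 x) modnDm.
have : all (fun i => all (fun j => (i ^ 2 + 6 * j ^ 2) %% 24
    \notin [:: 3; 5; 11; 13; 17; 19; 21; 23]) (iota 0 24)) (iota 0 24)
  by vm_compute.
have in24 z : z %% 24 \in iota 0 24 by rewrite mem_iota ltn_pmod.
by move=> /allP/(_ _ (in24 x))/allP/(_ _ (in24 y)).
Qed.

Theorem theorem4p3 (n : nat) :
  [/\ overpbar 6 (9 * n + 6) = 0 %[mod 3],
      overpbar 6 (8 * n + 3) = 0 %[mod 8],
      overpbar 6 (8 * n + 5) = 0 %[mod 8],
      overpbar 6 (24 * n + 17) = 0 %[mod 8] &
      overpbar 6 (24 * n + 23) = 0 %[mod 8]].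
Proof.
have mod8 t : odd t -> t %% 24 \in [:: 3; 5; 11; 13; 17; 19; 21; 23] ->
    overpbar 6 t = 0 %[mod 8].
  move=> todd t24; apply: overpbar6_mod8 => // x y xy.
  by have := sqr_add_6sqr_mod24 x y; rewrite xy t24.
split; first exact: overpbar6_mod3.
all: by apply: mod8; rewrite ?inE; lia.
Qed.
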